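(* Let $m,n$ be positive integers, let $\alpha_1,\dots,\alpha_m,\beta_1,\dots,\beta_n$ be elements of a field, and let $U(x)=\prod_{i=1}^m(1-\alpha_i x)$ and $V(x)=\prod_{j=1}^n(1-\beta_j x)$. Then $$\prod_{i=1}^m\prod_{j=1}^n\bigl(1-(\alpha_i+\beta_j)x\bigr)=(-1)^{mn}\operatorname{Res}\left((1-y)^mU\Bigl(\frac{x}{1-y}\Bigr),\;y^nV\Bigl(\frac{x}{y}\Bigr),\;y\right).$$
   Context: For polynomials $P(y)=a_m\prod_{i=1}^m(y-\rho_i)$ of degree $m$ and $Q(y)=b_n\prod_{j=1}^n(y-\sigma_j)$ of degree $n$ in the variable $y$ (with coefficients in a field, roots taken in an extension field), the resultant with respect to $y$ is $\operatorname{Res}(P(y),Q(y),y)=a_m^nb_n^m\prod_{i,j}(\rho_i-\sigma_j)$. In the claim, $x$ and $y$ are independent indeterminates, and $(1-y)^mU(x/(1-y))$ and $y^nV(x/y)$ are polynomials in $y$ with coefficients that are polynomials in $x$. *)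

(* Defs.v *)
From mathcomp Require Import all_boot all_order all_algebra.
From mathcomp Require Import boolp classical_sets.

Set Implicit Arguments.
Unset Strict Implicit.
Unset Printing Implicit Defensive.

Import GRing.Theory.
Local Open Scope ring_scope.

(* The roots rho of P and sigma of Q live in some extension field f : K -> L;
   a and b are the leading coefficients, so that deg P = size rho and
   deg Q = size sigma. *)
Definition is_resultant (K : fieldType) (P Q : {poly K}) (r : K) : Prop :=
  exists (L : fieldType) (f : {rmorphism K -> L}) (a b : K)
    (rho sigma : seq L),
    [/\ a != 0, b != 0,
        map_poly f P = f a *: \prod_(u <- rho) ('X - u%:P),
        map_poly f Q = f b *: \prod_(v <- sigma) ('X - v%:P)
      & f r = f a ^+ size sigma * f b ^+ size rho *
              \prod_(u <- rho) \prod_(v <- sigma) (u - v)].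

(* This is not [mxpoly.resultant]: the latter takes the rows of the Sylvester
   matrix in increasing powers of 'X, which multiplies the value by
   (-1) ^+ (deg P * deg Q).
   The value does not depend on the extension nor on the enumeration of the
   roots (is_resultant_uniq); the default 0 is for P = 0 or Q = 0. *)
Definition Res (K : fieldType) (P Q : {poly K}) : K :=
  xget 0 [set r | is_resultant P Q r]%classic.

Lemma size_lead_split (K L : fieldType) (f : {rmorphism K -> L})
    (P : {poly K}) (a : K) (s : seq L) :
  a != 0 -> map_poly f P = f a *: \prod_(u <- s) ('X - u%:P) ->
  size P = (size s).+1 /\ lead_coef P = a.
Proof.
move=> a0 e; have fa0 : f a != 0 by rewrite fmorph_eq0.
split; first by rewrite -(size_map_poly f) e size_scale // size_prod_XsubC.
apply: (fmorph_inj f); rewrite -lead_coef_map e lead_coefZ.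
by rewrite (monicP (monic_prod_XsubC _ _ _)) mulr1.
Qed.

Lemma companion_exists (K : fieldType) (P : {poly K}) (k : nat) :
  P \is monic -> size P = k.+2 -> exists A : 'M[K]_k.+1, char_poly A = P.
Proof.
move=> Pm sP; have s1 : (1 < size P)%N by rewrite sP.
have : char_poly (companionmx P) = P by apply: companionmxK.
move: (companionmx P); rewrite sP /= => A eA; by exists A.
Qed.

Lemma det_horner_split (L : fieldType) (k : nat) (A : 'M[L]_k.+1) (c : L)
    (rho sigma : seq L) :
  char_poly A = \prod_(u <- rho) ('X - u%:P) ->
  \det (horner_mx A (c *: \prod_(v <- sigma) ('X - v%:P))) =
  c ^+ k.+1 * \prod_(u <- rho) \prod_(v <- sigma) (u - v).
Proof.
move=> eA; have srho : size rho = k.+1.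
  by have := size_char_poly A; rewrite eA size_prod_XsubC => -[].
rewrite linearZ /= detZ; congr (_ * _).
rewrite rmorph_prod /= (big_morph _ (@det_mulmx _ _) (det1 _ _)) exchange_big /=.
apply: eq_bigr => v _.
have -> : horner_mx A ('X - v%:P) = - (v%:M - A).
  by rewrite rmorphB /= horner_mx_X horner_mx_C opprB.
have <- : map_mx (horner_eval v) (char_poly_mx A) = v%:M - A.
  apply/matrixP => i j; rewrite !mxE /horner_eval !hornerE hornerMn hornerX.
  by [].
rewrite -scaleN1r detZ det_map_mx -/(char_poly A) eA /= /horner_eval.
rewrite horner_prod -srho; clear eA srho.
elim: rho => [|u rho IH]; first by rewrite !big_nil mulr1.
rewrite exprS !big_cons mulrACA IH; congr (_ * _).
by rewrite !hornerE mulN1r opprB.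
Qed.

Lemma is_resultant_uniq (K : fieldType) (P Q : {poly K}) (r s : K) :
  is_resultant P Q r -> is_resultant P Q s -> r = s.
Proof.
suff [c cP] : exists c, forall t, is_resultant P Q t -> t = c.
  by move=> /cP-> /cP->.
case sP : (size P) => [|[|k]].
- exists 0 => t [L [f [a [b [rho [sigma [a0 b0 eP _ _]]]]]]].
  by have [] := size_lead_split a0 eP; rewrite sP.
- exists (lead_coef P ^+ (size Q).-1).
  move=> t [L [f [a [b [rho [sigma [a0 b0 eP eQ et]]]]]]].
  have [] := size_lead_split a0 eP; rewrite sP => -[/esym/size0nil e] ->.
  have [-> _] := size_lead_split b0 eQ.
  apply: (fmorph_inj f); rewrite et e big_nil /= expr0 !mulr1.
  by rewrite rmorphXn.
have l0 : lead_coef P != 0 by rewrite lead_coef_eq0 -size_poly_eq0 sP.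
have [||A eA] := @companion_exists K ((lead_coef P)^-1 *: P) k.
- by rewrite monicE lead_coefZ mulVf.
- by rewrite size_scale ?invr_eq0.
exists (lead_coef P ^+ (size Q).-1 * \det (horner_mx A Q)).
move=> t [L [f [a [b [rho [sigma [a0 b0 eP eQ et]]]]]]].
have [] := size_lead_split a0 eP; rewrite sP => -[srho] la.
have [sQ _] := size_lead_split b0 eQ.
apply: (fmorph_inj f); rewrite et rmorphM rmorphXn /= sQ la -det_map_mx.
rewrite map_horner_mx eQ (@det_horner_split _ _ _ _ rho) -?srho ?mulrA //.
rewrite -map_char_poly eA la map_polyZ eP scalerA fmorphV mulVf ?scale1r //.
by rewrite fmorph_eq0.
Qed.

Lemma ResE (K : fieldType) (P Q : {poly K}) (r : K) :
  is_resultant P Q r -> Res P Q = r.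
Proof. by move=> Pr; apply: xget_unique => // s /is_resultant_uniq; apply. Qed.

(* In {poly {poly F}} the outer variable is y and the inner one is x;
   F(x, y) is the fraction field of F[x][y]. *)
Definition Fxy (F : fieldType) : fieldType := {fraction {poly {poly F}}}.

Definition xvar (F : fieldType) : Fxy F := tofrac ('X%:P : {poly {poly F}}).

Definition yvar (F : fieldType) : Fxy F := tofrac ('X : {poly {poly F}}).

Definition evalxy (F : fieldType) (U : {poly F}) (w : Fxy F) : Fxy F :=
  (map_poly (fun c : F => tofrac (c%:P%:P : {poly {poly F}})) U).[w].

(* F[x][y] -> F(x)[y] *)
Definition coefs_in_Fx (F : fieldType) (P : {poly {poly F}}) :
    {poly {fraction {poly F}}} :=
  map_poly (@tofrac {poly F}) P.

(* Main.v *)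
Require Import Defs.
From mathcomp Require Import all_boot all_order all_algebra.
Import GRing.Theory.
Local Open Scope ring_scope.

(** Homogenizing [U] and [V] turns their reversed linear factors
    [1 - alpha_i x] and [1 - beta_j x] into linear polynomials in [y]:
    [(1 - y)^m U(x / (1 - y))] is the product of the [1 - y - alpha_i x], and
    [y^n V(x / y)] is the product of the [y - beta_j x]
    ([homogenize_reversed_prod]). Both are thus split over [F(x)] already, with
    roots [1 - alpha_i x] and [beta_j x] and leading coefficients [(-1)^m] and
    [1], so no further extension is needed to compute their resultant
    ([Res_split]): it is [((-1)^m)^n] times the product of the differences
    [(1 - alpha_i x) - beta_j x = 1 - (alpha_i + beta_j) x], and the two signs
    [(-1)^(mn)] cancel. *)

Lemma evalxy_reversed_prod (F : fieldType) (m : nat) (a : 'I_m -> F)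
    (w : Fxy F) :
  evalxy (\prod_(i < m) (1 - a i *: 'X)) w =
  \prod_(i < m) (1 - tofrac (a i)%:P%:P * w).
Proof.
rewrite /evalxy.
(* Exhibiting the coefficient embedding as a composite of ring morphisms. *)
rewrite -[fun c : F => _]/(@tofrac {poly {poly F}} \o (polyC \o polyC)).
rewrite rmorph_prod /= horner_prod; apply: eq_bigr => i _.
by rewrite rmorphB rmorph1 /= map_polyZ map_polyX /= !hornerE.
Qed.

(** The powers of [v] are shared out among the [m] factors, one each. *)
Lemma homogenize_reversed_prod (F : fieldType) (m : nat) (a : 'I_m -> F)
    (u v : Fxy F) :
  v != 0 ->
  v ^+ m * evalxy (\prod_(i < m) (1 - a i *: 'X)) (u / v) =
  \prod_(i < m) (v - tofrac (a i)%:P%:P * u).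
Proof.
move=> v0; rewrite evalxy_reversed_prod.
rewrite -[in v ^+ m](card_ord m) -prodr_const -big_split /=.
apply: eq_bigr => i _.
by rewrite mulrBr mulr1 mulrCA [v * _]mulrC divfK.
Qed.

Lemma Res_split (K : fieldType) (m n : nat) (a b : K)
    (rho : 'I_m -> K) (sigma : 'I_n -> K) :
  a != 0 -> b != 0 ->
  Res (a *: \prod_(i < m) ('X - (rho i)%:P))
      (b *: \prod_(j < n) ('X - (sigma j)%:P)) =
  a ^+ n * b ^+ m * \prod_(i < m) \prod_(j < n) (rho i - sigma j).
Proof.
move=> a0 b0; apply: ResE.
exists K, idfun, a, b, [seq rho i | i <- enum 'I_m],
  [seq sigma j | j <- enum 'I_n].
split=> //.
- by rewrite map_poly_id // big_map big_enum.
- by rewrite map_poly_id // big_map big_enum.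
rewrite 2!size_map !size_enum_ord big_map big_enum /=; congr (_ * _).
by apply: eq_bigr => i _; rewrite big_map big_enum.
Qed.

Theorem theorem10 (F : fieldType) (m n : nat) (hm : (0 < m)%N) (hn : (0 < n)%N)
    (alpha : 'I_m -> F) (beta : 'I_n -> F) :
  let U : {poly F} := \prod_(i < m) (1 - alpha i *: 'X) in
  let V : {poly F} := \prod_(j < n) (1 - beta j *: 'X) in
  let x := xvar F in
  let y := yvar F in
  exists P Q : {poly {poly F}},
    [/\ tofrac P = (1 - y) ^+ m * evalxy U (x / (1 - y)),
        tofrac Q = y ^+ n * evalxy V (x / y)
      & tofrac (\prod_(i < m) \prod_(j < n) (1 - (alpha i + beta j) *: 'X)) =
        (-1) ^+ (m * n) * Res (coefs_in_Fx P) (coefs_in_Fx Q)].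
Proof.
move=> U V x y.
have y0 : y != 0 by rewrite tofrac_eq0 polyX_eq0.
have y1 : 1 - y != 0.
  rewrite -tofrac1 -tofracB tofrac_eq0 subr_eq0.
  by apply/eqP => /(congr1 (fun p : {poly _} => size p));
    rewrite size_poly1 size_polyX.
exists (\prod_(i < m) (1 - 'X - (alpha i *: 'X)%:P)),
  (\prod_(j < n) ('X - (beta j *: 'X)%:P)).
split.
- rewrite homogenize_reversed_prod // rmorph_prod; apply: eq_bigr => i _.
  by rewrite /= !tofracB tofrac1 -mul_polyC polyCM tofracM.
- rewrite homogenize_reversed_prod // rmorph_prod; apply: eq_bigr => j _.
  by rewrite /= tofracB -mul_polyC polyCM tofracM.
have -> : coefs_in_Fx (\prod_(i < m) (1 - 'X - (alpha i *: 'X)%:P)) =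
    (-1) ^+ m *: \prod_(i < m) ('X - (tofrac (1 - alpha i *: 'X))%:P).
  (* Each factor is minus a monic one: these are the signs in [(-1) ^+ m]. *)
  rewrite -[in (-1) ^+ m](card_ord m) -prodr_const -scaler_prod.
  rewrite /coefs_in_Fx rmorph_prod; apply: eq_bigr => i _ /=.
  rewrite !rmorphB /= !rmorph1 map_polyX map_polyC /= scaleN1r.
  by rewrite opprB addrAC.
have -> : coefs_in_Fx (\prod_(j < n) ('X - (beta j *: 'X)%:P)) =
    1 *: \prod_(j < n) ('X - (tofrac (beta j *: 'X))%:P).
  rewrite scale1r /coefs_in_Fx rmorph_prod; apply: eq_bigr => j _ /=.
  by rewrite rmorphB /= map_polyX map_polyC.
rewrite Res_split ?oner_eq0 ?signr_eq0 // expr1n mulr1 -exprM mulrA -expr2.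
rewrite sqrr_sign mul1r rmorph_prod; apply: eq_bigr => i _.
rewrite rmorph_prod; apply: eq_bigr => j _ /=.
by rewrite -tofracB scalerDl opprD addrA.
Qed.
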